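(* The assignment $\mathcal X\mapsto \mathrm{qPow}(\mathcal X):=(`\mathbb B)^{\mathcal X^*}$ extends to a functor $\mathrm{qPow}\colon\mathbf{qRel}\to\mathbf{qSet}$ that is right adjoint to the inclusion functor $\mathrm{Inc}\colon\mathbf{qSet}\to\mathbf{qRel}$. For each quantum set $\mathcal X$, the binary relation $\ni_{\mathcal X}$ from $\mathrm{qPow}(\mathcal X)$ to $\mathcal X$ is the $\mathcal X$-component of the counit of this adjunction.
   Context: A quantum set $\mathcal X$ is a set $\mathrm{At}(\mathcal X)$ of nonzero finite-dimensional complex Hilbert spaces, called its atoms. $L(X,Y)$ is the space of linear operators $X\to Y$. A binary relation $R$ from $\mathcal X$ to $\mathcal Y$ is a choice of subspaces $R(X,Y)\subseteq L(X,Y)$, one for each atom $X$ of $\mathcal X$ and each atom $Y$ of $\mathcal Y$. Composition: $(S\circ R)(X,Z)=\sum_{Y} S(Y,Z)\cdot R(X,Y)$, the sum over atoms $Y$ of $\mathcal Y$, where $V\cdot W$ is the span of the products $vw$. Adjoint: $R^\dagger(Y,X)=\{r^\dagger: r\in R(X,Y)\}$. Identity: $I_{\mathcal X}(X,X)=\mathbb C 1_X$, all other components zero. $R_1\le R_2$ iff $R_1(X,Y)\subseteq R_2(X,Y)$ for all atoms. $\mathbf{qRel}$ is the category of quantum sets and binary relations. A function $F\colon\mathcal X\to\mathcal Y$ is a binary relation with $F^\dagger\circ F\ge I_{\mathcal X}$ and $F\circ F^\dagger\le I_{\mathcal Y}$; quantum sets and functions form the subcategory $\mathbf{qSet}$ of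 $\mathbf{qRel}$. The Cartesian product $\mathcal X\times\mathcal Y$ has one atom $X\otimes Y$ for each pair of atoms, and $(R\times S)(X_1\otimes X_2,Y_1\otimes Y_2)=R(X_1,Y_1)\otimes S(X_2,Y_2)$. $\mathbf 1$ is the quantum set whose only atom is $\mathbb C$. The symmetric monoidal category $(\mathbf{qSet},\times,\mathbf 1)$ is closed (known): for quantum sets $\mathcal Y,\mathcal Z$ there are a quantum set $\mathcal Z^{\mathcal Y}$ and a function $\mathrm{Eval}\colon\mathcal Z^{\mathcal Y}\times\mathcal Y\to\mathcal Z$ such that each function $F\colon\mathcal X\times\mathcal Y\to\mathcal Z$ equals $\mathrm{Eval}\circ(G\times I_{\mathcal Y})$ for a unique function $G\colon\mathcal X\to\mathcal Z^{\mathcal Y}$. For an ordinary set $A$, $`A$ is the quantum set with one one-dimensional atom $\mathbb C_a$ for each $a\in A$; for an ordinary binary relation $r\subseteq A\times B$, $`r(\mathbb C_a,\mathbb C_b)=L(\mathbb C_a,\mathbb C_b)$ if $(a,b)\in r$ and $0$ otherwise. $\mathbb B=\{0,1\}$, and $`1\colon\mathbf 1=`\{\ast\}\to`\mathbb B$ is induced by the function $\{\ast\}\to\mathbb B$ with value $1$. The dual $\mathcal X^*$ is the quantum set whose atoms are the duals $X^*=L(X,\mathbb C)$ of the atoms $X$ of $\mathcal X$. $E_{\mathcal X}$ is the binary relation from $\mathcal X\times\mathcal X^*$ to $\mathbf 1$ with $E_{\mathcal X}(X\otimes X^*,\mathbb C)=\mathbb C\,\epsilon_X$, where $\epsilon_X\colon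 X\otimes X^*\to\mathbb C$ is the evaluation pairing, and all other components zero. With $E_{\mathcal X}$, $\mathcal X$ is an internal hom from $\mathcal X^*$ to $\mathbf 1$ in $\mathbf{qRel}$, so there is a unique binary relation $\ni_{\mathcal X}$ from $\mathrm{qPow}(\mathcal X)$ to $\mathcal X$ with $E_{\mathcal X}\circ(\ni_{\mathcal X}\times I_{\mathcal X^*})=`1^\dagger\circ\mathrm{Eval}$, where $\mathrm{Eval}\colon\mathrm{qPow}(\mathcal X)\times\mathcal X^*\to`\mathbb B$. *)

(* Defs.v *)
From HB Require Import structures.
From mathcomp Require Import all_boot all_order all_algebra.
From mathcomp Require Import boolp reals complex.

Set Implicit Arguments.
Unset Strict Implicit.
Unset Printing Implicit Defensive.

Import Order.TTheory GRing.Theory Num.Theory Num.Def.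
Local Open Scope ring_scope.

(* A finite-dimensional Hilbert space. The inner product [hdot] is linear in its
   first argument and conjugate-linear in the second; completeness is automatic
   in finite dimension. *)
Record hilbert (C : numClosedFieldType) := Hilbert {
  hcar :> vectType C;
  hdot : {dot hcar for conjC}
}.

Notation "''[' u , v ]" := (hdot _ u%R v%R) : ring_scope.

Section OrthonormalBasis.
Variables (C : numClosedFieldType) (X : hilbert C).
Implicit Types x y : X.

Lemma hdotC x y : '[x, y] = '[y, x]^*.
Proof. by rewrite hermC mul1r. Qed.

Lemma gram_schmidt (s : seq X) :
  exists t : seq X, orthonormal (@hdot C X) t /\ <<t>>%VS = <<s>>%VS.
Proof.
elim: s => [|v s [t [ot st]]]; first by exists [::].
have [x xt [y [-> _ yt]]] := orthogonal_split (@hdot C X) t v.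
have xs : (<[x]> <= <<s>>)%VS by rewrite -memvE -st.
have [y0|y0] := eqVneq y 0.
  by exists t; rewrite y0 addr0 span_cons st (addv_idPr xs).
have ny0 : sqrtC '[y, y] != 0 by rewrite sqrtC_eq0 dnorm_eq0.
exists ((sqrtC '[y, y])^-1 *: y :: t); split.
  rewrite -cat1s orthonormal_cat ot /=; apply/andP; split.
    rewrite /orthonormal /= !andbT dnormZ normfV ger0_norm; last first.
      by rewrite sqrtC_ge0 dnorm_ge0.
    by rewrite exprVn sqrtCK mulVf // dnorm_eq0.
  apply/orthoPl => z zt; rewrite linearZl_LR /=.
  by rewrite (orthoPl yt z zt) mulr0.
apply/eqP; rewrite eqEsubv; apply/andP; split; apply/span_subvP => z.
  rewrite inE => /predU1P[->|zt]; last first.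
    by rewrite span_cons -st; apply: subvP (addvSr _ _) _ (memv_span zt).
  have xys : x + y \in <<(x + y)%R :: s>>%VS by rewrite memv_span ?mem_head.
  have xs' : x \in <<(x + y)%R :: s>>%VS.
    by rewrite span_cons; apply: subvP (addvSr _ _) _ _; rewrite memvE.
  have yE : y = (x + y) - x by rewrite addrC addKr.
  by apply: memvZ; have := memvB xys xs'; rewrite -yE.
rewrite inE => /predU1P[->|zs]; last first.
  by rewrite span_cons st; apply: subvP (addvSr _ _) _ (memv_span zs).
have xt' : x \in <<((sqrtC '[y, y])^-1 *: y)%R :: t>>%VS.
  by rewrite span_cons; apply: subvP (addvSr _ _) _ _.
apply: memvD => //; rewrite -[y in y \in _](scalerKV ny0).
by apply: memvZ; rewrite memv_span ?mem_head.
Qed.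

Lemma ex_onb : exists e : seq X,
  orthonormal (@hdot C X) e /\ basis_of fullv e.
Proof.
have [e [oe se]] := gram_schmidt (vbasis fullv); exists e; split=> //.
by rewrite /basis_of se (span_basis (vbasisP _)) eqxx (orthonormal_free oe).
Qed.

Definition onb : seq X := projT1 (cid ex_onb).

Lemma onb_orthonormal : orthonormal (@hdot C X) onb.
Proof. by rewrite /onb; case: cid => ? []. Qed.

Lemma onb_basis : basis_of fullv onb.
Proof. by rewrite /onb; case: cid => ? []. Qed.

Lemma onb_uniq : uniq onb.
Proof. by have /orthonormalP[] := onb_orthonormal. Qed.

Lemma onb_dot x y : x \in onb -> y \in onb -> '[x, y] = (x == y)%:R.
Proof. by have /orthonormalP[_] := onb_orthonormal; apply. Qed.

Lemma onb_dec x : x = \sum_(e <- onb) '[x, e] *: e.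
Proof.
have : x \in <<onb>>%VS by rewrite (span_basis onb_basis) memvf.
move=> /(@coord_span _ _ _ (in_tuple onb)) => dx.
rewrite [LHS]dx [RHS]big_tnth; apply: eq_bigr => i _.
rewrite (tnth_nth 0) /=; congr (_ *: _).
rewrite [in RHS]dx linear_sumlz /= (bigD1 i) //= linearZl_LR /=.
rewrite onb_dot ?mem_nth // eqxx mulr1 big1 ?addr0 // => j ji.
rewrite linearZl_LR /= onb_dot ?mem_nth // nth_uniq ?onb_uniq //.
by move: ji; rewrite -val_eqE => /negPf /= ->; rewrite mulr0.
Qed.

Lemma hdot_onb x y : '[x, y] = \sum_(e <- onb) '[x, e] * '[e, y].
Proof.
rewrite [in LHS](onb_dec x) linear_sumlz.
by apply: eq_bigr => e _; rewrite linearZl_LR.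
Qed.

Lemma hdot_inj x y : (forall z : X, '[z, x] = '[z, y]) -> x = y.
Proof.
move=> xy; rewrite (onb_dec x) (onb_dec y); apply: eq_bigr => e _.
by rewrite hdotC xy -hdotC.
Qed.

End OrthonormalBasis.

Section HilbertSchmidt.
Variables (C : numClosedFieldType) (X Y : hilbert C).
Implicit Types A B : 'Hom(X, Y).

(* The Hilbert-Schmidt inner product tr(B^dagger A), computed in a chosen
   orthonormal basis of [X]. *)
Definition hs_form A B : C := \sum_(e <- onb X) '[A e, B e].

Let hs_bilinear : bilinear_for *%R (conjC \; *%R) hs_form.
Proof.
split=> [B a A A'|A a B B']; rewrite /hs_form /= mulr_sumr -big_split /=;
  apply: eq_bigr => e _; rewrite add_lfunE scale_lfunE.
  by rewrite linearDl linearZl_LR.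
by rewrite linearDr linearZr_LR.
Qed.

Let hs_herm A B : hs_form A B = (-1) ^+ false * conjC (hs_form B A).
Proof.
rewrite mul1r rmorph_sum; apply: eq_bigr => e _; exact: hdotC.
Qed.

Let hs_pos A : A != 0 -> 0 < hs_form A A.
Proof.
move=> A0; rewrite lt0r sumr_ge0 ?andbT => [|e _]; last exact: dnorm_ge0.
apply: contra A0; rewrite psumr_eq0 => [/allP hA|e _]; last exact: dnorm_ge0.
apply/eqP/lfunP => x; rewrite (onb_dec x) !linear_sum big_seq [RHS]big_seq.
apply: eq_bigr => e /hA; rewrite dnorm_eq0 => /eqP Ae.
by rewrite !linearZ /= Ae zero_lfunE.
Qed.

HB.instance Definition _ := bilinear_isBilinear.Build C _ _ _ _ _ hs_form hs_bilinear.
HB.instance Definition _ := isHermitianSesquilinear.Build C _ _ _ hs_form hs_herm.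
HB.instance Definition _ := isDotProduct.Build C _ hs_form hs_pos.

Definition hom_hilb : hilbert C := @Hilbert C 'Hom(X, Y) hs_form.
End HilbertSchmidt.


Section Scalars.
Variable C : numClosedFieldType.

Definition scal_form (a b : C^o) : C := a * b^*.

Let scal_bilinear : bilinear_for *%R (conjC \; *%R) scal_form.
Proof.
split=> [b a x y|b a x y]; rewrite /scal_form.
  by rewrite mulrDl -mulrA.
by rewrite rmorphD rmorphM mulrDr mulrCA.
Qed.

Let scal_herm a b : scal_form a b = (-1) ^+ false * conjC (scal_form b a).
Proof. by rewrite mul1r /scal_form rmorphM /= conjCK mulrC. Qed.

Let scal_pos a : a != 0 -> 0 < scal_form a a.
Proof. by move=> a0; rewrite /scal_form mul_conjC_gt0. Qed.

HB.instance Definition _ :=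
  bilinear_isBilinear.Build C _ _ _ _ _ scal_form scal_bilinear.
HB.instance Definition _ :=
  isHermitianSesquilinear.Build C _ _ _ scal_form scal_herm.
HB.instance Definition _ := isDotProduct.Build C _ scal_form scal_pos.

Definition scal_hilb : hilbert C := @Hilbert C C^o scal_form.

End Scalars.
Arguments scal_hilb {C}.

Lemma linfunE (K : nzRingType) (U V : vectType K) (f : U -> V) :
  linear f -> linfun f =1 f.
Proof.
move=> lf x.
pose F : {linear U -> V} := HB.pack f (GRing.isLinear.Build _ _ _ _ f lf).
exact: (lfunE F).
Qed.

Lemma lin_sum (K : nzRingType) (U V : lmodType K) (f : U -> V) I (r : seq I)
    (a : I -> K) (u : I -> U) :
  linear f -> f (\sum_(i <- r) a i *: u i) = \sum_(i <- r) a i *: f (u i).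
Proof.
move=> lf.
pose F : {linear U -> V} := HB.pack f (GRing.isLinear.Build _ _ _ _ f lf).
rewrite -[f]/(F : U -> V) linear_sum.
by apply: eq_bigr => i _; rewrite linearZ.
Qed.

Lemma lin_scale (K : nzRingType) (U V : lmodType K) (f : U -> V) a u :
  linear f -> f (a *: u) = a *: f u.
Proof.
by move=> lf; have := lin_sum [:: tt] (fun=> a) (fun=> u) lf; rewrite !big_seq1.
Qed.

Section Adjoint.
Variables (C : numClosedFieldType) (X Y : hilbert C).

(* The adjoint: [adjP] below is its defining property. *)
Definition adj (r : 'Hom(X, Y)) : 'Hom(Y, X) :=
  linfun (fun y => \sum_(e <- onb X) '[y, r e] *: e).

Lemma adjP (r : 'Hom(X, Y)) x y : '[r x, y] = '[x, adj r y].
Proof.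
rewrite linfunE => [|a u v]; last first.
  rewrite scaler_sumr -big_split; apply: eq_bigr => e _ /=.
  by rewrite linearDl linearZl_LR scalerDl scalerA.
rewrite linear_sumr [in LHS](onb_dec x) linear_sum linear_sumlz.
apply: eq_bigr => e _.
by rewrite linearZr_LR /= linearZ linearZl_LR /= -hdotC mulrC.
Qed.

End Adjoint.

Section Tensor.
Variables (C : numClosedFieldType).
Implicit Types (X Y Z : hilbert C).

(* X^* = L(X, C); the Hilbert-Schmidt inner product on it is the one for which
   x |-> <-, x> is antiunitary. *)
Definition dual_hilb X : hilbert C := hom_hilb X scal_hilb.

(* The tensor product X (x) Y, realized as L(X^* , Y) with x (x) y the operator
   phi |-> phi(x) y. That this is the Hilbert space tensor product is the content
   of [tens_span], [dot_tens] and the universal property [tens_liftE]. *)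
Definition tens_hilb X Y : hilbert C := hom_hilb (dual_hilb X) Y.

Definition tens X Y (x : X) (y : Y) : tens_hilb X Y :=
  linfun (fun phi : dual_hilb X => phi x *: y).

Definition bra X (x : X) : dual_hilb X := linfun (fun z => '[z, x] : C^o).

(* The linear map with x (x) y |-> b x y, when [b] is bilinear: see [tens_liftE]. *)
Definition tens_lift X Y Z (b : X -> Y -> Z) : 'Hom(tens_hilb X Y, Z) :=
  linfun (fun t : tens_hilb X Y => \sum_(e <- onb X) b e (t (bra e))).

(* f (x) g, characterized by [tens_mapE]. *)
Definition tens_map X1 X2 Y1 Y2 (f : 'Hom(X1, Y1)) (g : 'Hom(X2, Y2)) :
    'Hom(tens_hilb X1 X2, tens_hilb Y1 Y2) :=
  tens_lift (fun x1 x2 => tens (f x1) (g x2)).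

(* x (x) phi |-> phi(x): see [ev_pairingE]. *)
Definition ev_pairing X : 'Hom(tens_hilb X (dual_hilb X), scal_hilb) :=
  tens_lift (fun (x : X) (phi : dual_hilb X) => phi x).

Lemma braE X (x z : X) : bra x z = '[z, x].
Proof. by rewrite linfunE // => a u v; rewrite linearDl linearZl_LR. Qed.

Lemma tensE X Y (x : X) (y : Y) (phi : dual_hilb X) : tens x y phi = phi x *: y.
Proof.
by rewrite linfunE // => a f g; rewrite add_lfunE scale_lfunE scalerDl scalerA.
Qed.

Lemma tens_bilinear X Y :
  bilinear_for *:%R *:%R (@tens X Y : X -> Y -> tens_hilb X Y).
Proof.
split=> [y|x] a u v; apply/lfunP => phi; rewrite add_lfunE scale_lfunE !tensE.
  by rewrite linearP scalerDl scalerA.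
by rewrite scalerDr !scalerA mulrC.
Qed.

Lemma tens_hilbE X Y (t : tens_hilb X Y) :
  t = \sum_(e <- onb X) tens e (t (bra e)).
Proof.
apply/lfunP => phi; rewrite sum_lfunE.
have -> : phi = \sum_(e <- onb X) phi e *: bra e.
  apply/lfunP => x; rewrite sum_lfunE {1}(onb_dec x) linear_sum.
  by apply: eq_bigr => e _; rewrite linearZ scale_lfunE braE [LHS]mulrC.
rewrite [LHS]linear_sum; apply: eq_big_seq => e eX.
rewrite linearZ tensE sum_lfunE (bigD1_seq e) ?onb_uniq //= big1_seq ?addr0.
  rewrite scale_lfunE braE onb_dot // eqxx; congr (_ *: _).
  by rewrite [RHS]mulr1.
move=> f /andP[fe fX]; rewrite scale_lfunE braE onb_dot // eq_sym (negPf fe).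
by rewrite scaler0.
Qed.

Lemma tens_span X Y :
  <<[seq tens x y | x <- onb X, y <- onb Y]>>%VS = {: tens_hilb X Y}%VS.
Proof.
apply/eqP; rewrite eqEsubv subvf /=; apply/subvP => t _.
rewrite (tens_hilbE t) big_seq; apply: memv_suml => e eX.
have [_ te] := tens_bilinear X Y.
rewrite (onb_dec (t (bra e))) (lin_sum _ _ _ (te e)).
rewrite big_seq; apply: memv_suml => f fY.
apply: memvZ; apply: memv_span; exact: allpairs_f.
Qed.

Lemma tens_liftE X Y Z (b : X -> Y -> Z) :
  bilinear_for *:%R *:%R b -> forall x y, tens_lift b (tens x y) = b x y.
Proof.
move=> [bl br] x y; rewrite linfunE => [|a s t]; last first.
  rewrite scaler_sumr -big_split; apply: eq_bigr => e _ /=.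
  by rewrite add_lfunE scale_lfunE br.
rewrite {2}(onb_dec x) (lin_sum _ _ _ (bl y)); apply: eq_bigr => e _.
by rewrite tensE braE (lin_scale _ _ (br e)).
Qed.

Lemma dot_tens X Y (x x' : X) (y y' : Y) :
  '[tens x y, tens x' y'] = '[x, x'] * '[y, y'].
Proof.
rewrite [LHS]/(hs_form _ _) /hs_form.
transitivity (\sum_(phi <- onb (dual_hilb X)) (phi x * (phi x')^* * '[y, y'])).
  apply: eq_bigr => phi _; rewrite !tensE linearZl_LR linearZr_LR /=.
  by rewrite mulrA.
rewrite -mulr_suml; congr (_ * _).
have E (u : X) (phi : dual_hilb X) : phi u = '[phi, bra u].
  rewrite [RHS]/(hs_form _ _) /hs_form {1}(onb_dec u) linear_sum.
  apply: eq_bigr => e _; rewrite linearZ /= /scal_form braE -hdotC.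
  exact: mulrC.
transitivity ('[bra x', bra x]).
  rewrite hdot_onb; apply: eq_bigr => phi _; rewrite !E mulrC.
  by rewrite hdotC conjCK.
by rewrite -E braE.
Qed.

Lemma tens_mapE X1 X2 Y1 Y2 (f : 'Hom(X1, Y1)) (g : 'Hom(X2, Y2)) x1 x2 :
  tens_map f g (tens x1 x2) = tens (f x1) (g x2).
Proof.
have [tl tr] := tens_bilinear Y1 Y2.
rewrite /tens_map tens_liftE //; split=> [y|x] a u v /=.
  by rewrite linearP tl.
by rewrite linearP tr.
Qed.

Lemma ev_pairingE X (x : X) (phi : dual_hilb X) :
  ev_pairing X (tens x phi) = phi x.
Proof.
rewrite /ev_pairing tens_liftE //; split=> [f|y] a u v; first by rewrite linearP.
by rewrite add_lfunE scale_lfunE.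
Qed.

End Tensor.

Section AdjointTheory.
Variables (C : numClosedFieldType).
Implicit Types (X Y Z : hilbert C).

Lemma adj_uniq X Y (r : 'Hom(X, Y)) (s : 'Hom(Y, X)) :
  (forall x y, '[r x, y] = '[x, s y]) -> adj r = s.
Proof. by move=> rs; apply/lfunP => y; apply: hdot_inj => x; rewrite -adjP. Qed.

Lemma adjK X Y (r : 'Hom(X, Y)) : adj (adj r) = r.
Proof. by apply: adj_uniq => y x; rewrite hdotC -adjP -hdotC. Qed.

Lemma adj1 X : adj (\1%VF : 'Hom(X, X)) = \1%VF.
Proof. by apply: adj_uniq => x y; rewrite !id_lfunE. Qed.

Lemma adj_comp X Y Z (r : 'Hom(X, Y)) (s : 'Hom(Y, Z)) :
  adj (s \o r)%VF = (adj r \o adj s)%VF.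
Proof. by apply: adj_uniq => x y; rewrite !comp_lfunE -!adjP. Qed.

Lemma adj_semilinear X Y a (r s : 'Hom(X, Y)) :
  adj (a *: r + s) = a^* *: adj r + adj s.
Proof.
apply: adj_uniq => x y; rewrite !add_lfunE !scale_lfunE linearDl linearDr.
by rewrite linearZl_LR linearZr_LR /= conjCK !adjP.
Qed.

Lemma adj0 X Y : adj (0 : 'Hom(X, Y)) = 0.
Proof.
by apply: adj_uniq => x y; rewrite !zero_lfunE linear0l linear0r.
Qed.

End AdjointTheory.

Section Subspaces.
Variable C : numClosedFieldType.

Lemma ex_vsum (V : vectType C) I (F : I -> {vspace V}) : exists U : {vspace V},
  (forall i, (F i <= U)%VS) /\ exists s : seq I, U = (\sum_(i <- s) F i)%VS.
Proof.
pose P n := `[< exists s : seq I, \dim (\sum_(i <- s) F i)%VS = n >].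
have P0 : exists n, P n.
  by exists 0%N; apply/asboolP; exists [::]; rewrite big_nil dimv0.
have Pmax n : P n -> (n <= \dim {:V})%N.
  by move=> /asboolP[s <-]; apply/dimvS/subvf.
case: (ex_maxnP P0 Pmax) => n /asboolP[s sn] nmax.
exists (\sum_(i <- s) F i)%VS; split=> [i|]; last by exists s.
have : (\dim (\sum_(j <- i :: s) F j)%VS <= n)%N.
  by apply: nmax; apply/asboolP; exists (i :: s).
rewrite big_cons => le_n.
have /eqP -> : (\sum_(j <- s) F j == F i + \sum_(j <- s) F j)%VS.
  by rewrite eqEdim addvSr sn.
exact: addvSl.
Qed.

(* The sum of an arbitrary family of subspaces: by finite dimension it is the
   sum of a finite subfamily. *)
Definition vsum (V : vectType C) I (F : I -> {vspace V}) : {vspace V} :=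
  projT1 (cid (ex_vsum F)).

Lemma vsum_sup (V : vectType C) I (F : I -> {vspace V}) i : (F i <= vsum F)%VS.
Proof. by rewrite /vsum; case: cid => U []. Qed.

Lemma vsum_sub (V : vectType C) I (F : I -> {vspace V}) (U : {vspace V}) :
  (forall i, (F i <= U)%VS) -> (vsum F <= U)%VS.
Proof.
move=> FU; rewrite /vsum; case: cid => W /= [_ [s ->]].
by elim/big_rec: _ => [|i W' _ W'U]; rewrite ?sub0v // subv_add FU.
Qed.

(* The span of the products s \o r, as for [prodv] in [falgebra]; see
   [memv_mulv] and [mulv_sub]. *)
Definition mulv (X Y Z : vectType C) (V : {vspace 'Hom(Y, Z)})
    (W : {vspace 'Hom(X, Y)}) : {vspace 'Hom(X, Z)} :=
  <<[seq (s \o r)%VF | s <- vbasis V, r <- vbasis W]>>%VS.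

Lemma mulv_sub (X Y Z : vectType C) (V : {vspace 'Hom(Y, Z)})
    (W : {vspace 'Hom(X, Y)}) (U : {vspace 'Hom(X, Z)}) :
  (forall s r, s \in V -> r \in W -> (s \o r)%VF \in U) -> (mulv V W <= U)%VS.
Proof.
move=> VWU; apply/span_subvP => _ /allpairsP[[s r] /= [sV rW ->]].
by apply: VWU; apply: vbasis_mem.
Qed.

Lemma memv_mulv (X Y Z : vectType C) (V : {vspace 'Hom(Y, Z)})
    (W : {vspace 'Hom(X, Y)}) s r :
  s \in V -> r \in W -> (s \o r)%VF \in mulv V W.
Proof.
move=> /coord_vbasis-> /coord_vbasis->.
have -> : (\sum_i coord (vbasis V) i s *: (vbasis V)`_i \o
    \sum_j coord (vbasis W) j r *: (vbasis W)`_j =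
    \sum_i \sum_j (coord (vbasis V) i s * coord (vbasis W) j r) *:
      ((vbasis V)`_i \o (vbasis W)`_j))%VF.
  apply/lfunP => x; rewrite comp_lfunE !sum_lfunE; apply: eq_bigr => i _.
  rewrite scale_lfunE !sum_lfunE linear_sum scaler_sumr; apply: eq_bigr => j _.
  by rewrite !scale_lfunE linearZ scalerA comp_lfunE.
apply: memv_suml => i _; apply: memv_suml => j _; apply: memvZ.
by apply: memv_span; apply: allpairs_f; apply: mem_nth; rewrite size_tuple.
Qed.

Lemma mulvS (X Y Z : vectType C) (V V' : {vspace 'Hom(Y, Z)})
    (W W' : {vspace 'Hom(X, Y)}) :
  (V <= V')%VS -> (W <= W')%VS -> (mulv V W <= mulv V' W')%VS.
Proof.
move=> /subvP VV /subvP WW; apply: mulv_sub => s r sV rW.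
by apply: memv_mulv; [apply: VV | apply: WW].
Qed.

(* The subspace of the adjoints of the elements of [V]: see [memv_adjv]. *)
Definition adjv (X Y : hilbert C) (V : {vspace 'Hom(X, Y)}) :
    {vspace 'Hom(Y, X)} :=
  <<[seq adj r | r <- vbasis V]>>%VS.

Lemma memv_adjv (X Y : hilbert C) (V : {vspace 'Hom(X, Y)}) t :
  (t \in adjv V) = (adj t \in V).
Proof.
have adj_in (U : {vspace 'Hom(X, Y)}) r : r \in U -> adj r \in adjv U.
  move=> /coord_vbasis->; elim/big_rec: _ => [|i s _ sU]; first by rewrite adj0 mem0v.
  rewrite adj_semilinear; apply: memvD => //; apply: memvZ; apply: memv_span.
  by apply: map_f; apply: mem_nth; rewrite size_tuple.
apply/idP/idP => [|/adj_in]; last by rewrite adjK.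
move=> /(@coord_span _ _ _ (in_tuple _)) ->.
elim/big_rec: _ => [|i s _ sV]; first by rewrite adj0 mem0v.
rewrite adj_semilinear; apply: memvD => //; apply: memvZ.
set u := _`_i; have : u \in [seq adj r | r <- vbasis V] by apply: mem_nth.
by case/mapP => r rV ->; rewrite adjK vbasis_mem.
Qed.

Definition tensv (X1 X2 Y1 Y2 : hilbert C) (V : {vspace 'Hom(X1, Y1)})
    (W : {vspace 'Hom(X2, Y2)}) :
    {vspace 'Hom(tens_hilb X1 X2, tens_hilb Y1 Y2)} :=
  <<[seq tens_map f g | f <- vbasis V, g <- vbasis W]>>%VS.

End Subspaces.

(* A quantum set, as a family of atoms indexed by an arbitrary type. *)
Record qset (C : numClosedFieldType) := QSet {
  At : Type;
  atom :> At -> hilbert C;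
  atom_neq0 : forall i, \dim {: atom i} != 0%N
}.

Section Relations.
Variable C : numClosedFieldType.
Implicit Types X Y Z : qset C.

Definition brel X Y := forall (i : At X) (j : At Y), {vspace 'Hom(X i, Y j)}.

Definition ble X Y (R S : brel X Y) := forall i j, (R i j <= S i j)%VS.

Definition bcomp X Y Z (S : brel Y Z) (R : brel X Y) : brel X Z :=
  fun i k => vsum (fun j => mulv (S j k) (R i j)).

Definition badj X Y (R : brel X Y) : brel Y X := fun j i => adjv (R i j).

(* The family equal to the line spanned by [v i] at (i, i) and zero elsewhere. *)
Definition diagv (I : Type) (V : I -> I -> vectType C) (v : forall i, V i i)
    (i j : I) : {vspace V i j} :=
  match pselect (i = j) with
  | left ij => ecast k {vspace V i k} ij <[v i]>%VS
  | right _ => 0%VS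
  end.

Lemma diagv_eq (I : Type) (V : I -> I -> vectType C) (v : forall i, V i i) i :
  diagv v i i = <[v i]>%VS.
Proof.
rewrite /diagv; case: pselect => // ii.
by rewrite (Prop_irrelevance ii (erefl i)).
Qed.

Lemma diagv_neq (I : Type) (V : I -> I -> vectType C) (v : forall i, V i i) i j :
  i <> j -> diagv v i j = 0%VS.
Proof. by rewrite /diagv; case: pselect. Qed.

Definition bid X : brel X X :=
  diagv (V := fun i j => 'Hom(X i, X j)) (fun i => \1%VF).
Arguments bid : clear implicits.

Lemma brelP X Y (R S : brel X Y) : (forall i j, R i j = S i j) -> R = S.
Proof.
by move=> RS; do 2![apply: functional_extensionality_dep => ?]; apply: RS.
Qed.

Lemma ble_anti X Y (R S : brel X Y) : ble R S -> ble S R -> R = S.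
Proof. by move=> RS SR; apply: brelP => i j; apply: subv_anti; rewrite RS SR. Qed.

Lemma ble_refl X Y (R : brel X Y) : ble R R.
Proof. by move=> i j. Qed.

Lemma ble_trans X Y (S R T : brel X Y) : ble R S -> ble S T -> ble R T.
Proof. by move=> RS ST i j; apply: subv_trans (RS i j) (ST i j). Qed.

Lemma bcompS X Y Z (S S' : brel Y Z) (R R' : brel X Y) :
  ble S S' -> ble R R' -> ble (bcomp S R) (bcomp S' R').
Proof.
move=> SS RR i k; apply: vsum_sub => j.
apply: subv_trans (vsum_sup _ j); exact: mulvS.
Qed.

Lemma memv_vsum (V : vectType C) I (F : I -> {vspace V}) i v :
  v \in F i -> v \in vsum F.
Proof. exact: subvP (vsum_sup F i) v. Qed.

Lemma mulv_vsuml (A B D : vectType C) I (F : I -> {vspace 'Hom(B, D)})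
    (W : {vspace 'Hom(A, B)}) U :
  (forall i, (mulv (F i) W <= U)%VS) -> (mulv (vsum F) W <= U)%VS.
Proof.
move=> FWU; apply: mulv_sub => s r sF rW.
have pre : (vsum F <= linfun (fun s => (s \o r)%VF) @^-1: U)%VS.
  apply: vsum_sub => i; apply/subvP => t tF; rewrite -memv_preim linfunE.
    by apply: subvP (FWU i) _ _; apply: memv_mulv.
  by move=> a u v; rewrite comp_lfunDl -comp_lfunZl.
have := subvP pre _ sF; rewrite -memv_preim linfunE //.
by move=> a u v; rewrite comp_lfunDl -comp_lfunZl.
Qed.

Lemma mulv_vsumr (A B D : vectType C) I (V : {vspace 'Hom(B, D)})
    (F : I -> {vspace 'Hom(A, B)}) U :
  (forall i, (mulv V (F i) <= U)%VS) -> (mulv V (vsum F) <= U)%VS.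
Proof.
move=> VFU; apply: mulv_sub => s r sV rF.
have pre : (vsum F <= linfun (fun r => (s \o r)%VF) @^-1: U)%VS.
  apply: vsum_sub => i; apply/subvP => t tF; rewrite -memv_preim linfunE.
    by apply: subvP (VFU i) _ _; apply: memv_mulv.
  by move=> a u v; rewrite comp_lfunDr -comp_lfunZr.
have := subvP pre _ rF; rewrite -memv_preim linfunE //.
by move=> a u v; rewrite comp_lfunDr -comp_lfunZr.
Qed.

Lemma mulvA (A B D E : vectType C) (U : {vspace 'Hom(D, E)})
    (V : {vspace 'Hom(B, D)}) (W : {vspace 'Hom(A, B)}) :
  mulv U (mulv V W) = mulv (mulv U V) W.
Proof.
apply/eqP; rewrite eqEsubv; apply/andP; split.
  apply: mulv_sub => u p uU pVW.
  have pre : (mulv V W <= linfun (fun p => (u \o p)%VF) @^-1: mulv (mulv U V) W)%VS.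
    apply: mulv_sub => v w vV wW; rewrite -memv_preim linfunE.
      by rewrite comp_lfunA; do 2?apply: memv_mulv.
    by move=> a x y; rewrite comp_lfunDr -comp_lfunZr.
  have := subvP pre _ pVW; rewrite -memv_preim linfunE //.
  by move=> a x y; rewrite comp_lfunDr -comp_lfunZr.
apply: mulv_sub => p w pUV wW.
have pre : (mulv U V <= linfun (fun p => (p \o w)%VF) @^-1: mulv U (mulv V W))%VS.
  apply: mulv_sub => u v uU vV; rewrite -memv_preim linfunE.
    by rewrite -comp_lfunA; do 2?apply: memv_mulv.
  by move=> a x y; rewrite comp_lfunDl -comp_lfunZl.
have := subvP pre _ pUV; rewrite -memv_preim linfunE //.
by move=> a x y; rewrite comp_lfunDl -comp_lfunZl.
Qed.

Lemma bcompA W X Y Z (T : brel Y Z) (S : brel X Y) (R : brel W X) :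
  bcomp T (bcomp S R) = bcomp (bcomp T S) R.
Proof.
apply: ble_anti => i l; apply: vsum_sub => k.
  apply: mulv_vsumr => j; rewrite mulvA.
  apply: subv_trans (vsum_sup _ j); apply: mulvS => //.
  exact: vsum_sup (fun k => mulv (T k l) (S j k)) k.
apply: mulv_vsuml => j; rewrite -mulvA.
apply: subv_trans (vsum_sup _ j); apply: mulvS => //.
exact: vsum_sup (fun k => mulv (S k j) (R i k)) k.
Qed.

Lemma bcomp1l X Y (R : brel X Y) : bcomp (bid Y) R = R.
Proof.
apply: ble_anti => i j.
  apply: vsum_sub => k; case: (pselect (k = j)) => [->|kj].
    2: apply: mulv_sub => s r; rewrite /bid diagv_neq // memv0 => /eqP-> _.
    2: by rewrite comp_lfun0l mem0v.
  apply: mulv_sub => s r; rewrite /bid diagv_eq => /vlineP[a ->] rR.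
  by rewrite -comp_lfunZl comp_lfun1l memvZ.
apply/subvP => r rR; apply: (@memv_vsum _ _ _ j).
by rewrite -[r]comp_lfun1l; apply: memv_mulv; rewrite // /bid diagv_eq memv_line.
Qed.

Lemma badjK X Y (R : brel X Y) : badj (badj R) = R.
Proof. by apply: brelP => i j; apply/vspaceP => t; rewrite !memv_adjv adjK. Qed.

Lemma badjS X Y (R S : brel X Y) : ble R S -> ble (badj R) (badj S).
Proof.
by move=> RS j i; apply/subvP => t; rewrite !memv_adjv; apply: subvP (RS i j) _.
Qed.

Lemma badj_comp X Y Z (S : brel Y Z) (R : brel X Y) :
  badj (bcomp S R) = bcomp (badj R) (badj S).
Proof.
have le (X' Y' Z' : qset C) (S' : brel Y' Z') (R' : brel X' Y') :
    ble (bcomp S' R') (badj (bcomp (badj R') (badj S'))).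
  move=> i k; apply: vsum_sub => j; apply: mulv_sub => s r sS rR.
  rewrite memv_adjv adj_comp; apply: (@memv_vsum _ _ _ j).
  by apply: memv_mulv; rewrite memv_adjv adjK.
apply: ble_anti; last by have := le _ _ _ (badj R) (badj S); rewrite !badjK.
by have := badjS (le _ _ _ S R); rewrite badjK.
Qed.

Lemma badj1_le X : ble (badj (bid X)) (bid X).
Proof.
move=> i j; case: (pselect (i = j)) => [->|ij]; apply/subvP => t.
  rewrite memv_adjv /bid diagv_eq => /vlineP[a ta].
  rewrite -[t]adjK ta -[a *: _]addr0 adj_semilinear adj1 memvD //.
    by rewrite memvZ // memv_line.
  by rewrite adj0 mem0v.
rewrite memv_adjv /bid !diagv_neq ?memv0 => [/eqP t0||ji]; last 2 first.
- by [].
- by apply: ij.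
by rewrite -[t]adjK t0 adj0.
Qed.

Lemma badj1 X : badj (bid X) = bid X.
Proof.
apply: ble_anti; first exact: badj1_le.
by have := badjS (@badj1_le X); rewrite badjK.
Qed.

Lemma bcomp1r X Y (R : brel X Y) : bcomp R (bid X) = R.
Proof. by rewrite -[LHS]badjK badj_comp badj1 bcomp1l badjK. Qed.

End Relations.
Arguments bid {C} X.

Section Functions.
Variable C : numClosedFieldType.
Implicit Types X Y Z : qset C.

Definition is_qfun X Y (F : brel X Y) :=
  ble (bid X) (bcomp (badj F) F) /\ ble (bcomp F (badj F)) (bid Y).

Record qfun X Y := QFun { qfun_rel :> brel X Y; qfunP : is_qfun qfun_rel }.

Lemma qfun_inj X Y (F G : qfun X Y) : F = G :> brel X Y -> F = G.
Proof.
case: F G => [F Fp] [G Gp] /= FG; move: Gp; rewrite -FG => Gp.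
by rewrite (Prop_irrelevance Fp Gp).
Qed.

Lemma is_qfun1 X : is_qfun (bid X).
Proof. by rewrite /is_qfun badj1 bcomp1l; split; apply: ble_refl. Qed.

Lemma is_qfun_comp X Y Z (G : qfun Y Z) (F : qfun X Y) : is_qfun (bcomp G F).
Proof.
have [[F1 F2] [G1 G2]] := (qfunP F, qfunP G); rewrite /is_qfun badj_comp; split.
  apply: ble_trans F1 _; rewrite -bcompA (bcompA (badj G)).
  apply: bcompS; first exact: ble_refl.
  have := bcompS G1 (@ble_refl _ _ _ F); by rewrite bcomp1l.
apply: ble_trans _ G2; rewrite -bcompA (bcompA F).
apply: bcompS; first exact: ble_refl.
by have := bcompS F2 (@ble_refl _ _ _ (badj G)); rewrite bcomp1l.
Qed.

Definition qfun_id X : qfun X X := QFun (is_qfun1 X).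
Definition qfun_comp X Y Z (G : qfun Y Z) (F : qfun X Y) : qfun X Z :=
  QFun (is_qfun_comp G F).
End Functions.

Lemma dim_hom (C : numClosedFieldType) (X Y : hilbert C) :
  \dim {: hom_hilb X Y} = (\dim {: X} * \dim {: Y})%N.
Proof. by rewrite !dimvf. Qed.

Section Constructions.
Variable C : numClosedFieldType.
Implicit Types X Y Z : qset C.

Lemma qdual_subproof X i : \dim {: dual_hilb (X i)} != 0%N.
Proof. by rewrite dim_hom muln_eq0 negb_or atom_neq0 dimvf. Qed.

Definition qdual X : qset C := QSet (@qdual_subproof X).

Lemma qprod_subproof X Y (p : At X * At Y) :
  \dim {: tens_hilb (X p.1) (Y p.2)} != 0%N.
Proof. by rewrite !dim_hom !muln_eq0 !negb_or !atom_neq0 dimvf. Qed.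

Definition qprod X Y : qset C := QSet (@qprod_subproof X Y).

Lemma quote_subproof (A : Type) (a : A) : \dim {: @scal_hilb C} != 0%N.
Proof. by rewrite dimvf. Qed.

(* The quantum set `A and, below, the relations induced by ordinary relations
   and functions. *)
Definition quote (A : Type) : qset C := QSet (@quote_subproof A).

Definition qone : qset C := quote unit.

Definition quote_rel (A B : Type) (r : A -> B -> Prop) :
    brel (quote A) (quote B) :=
  fun a b => if `[< r a b >] then fullv else 0%VS.

Definition quote_fun (A B : Type) (f : A -> B) : brel (quote A) (quote B) :=
  quote_rel (fun a b => f a = b).

Definition bprod X1 X2 Y1 Y2 (R : brel X1 Y1) (S : brel X2 Y2) :
    brel (qprod X1 X2) (qprod Y1 Y2) :=
  fun p q => tensv (R p.1 q.1) (S p.2 q.2).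

(* The relation E_X. *)
Definition qev X : brel (qprod X (qdual X)) qone :=
  fun p _ =>
    diagv (V := fun i j => 'Hom(tens_hilb (X i) (dual_hilb (X j)), scal_hilb))
      (fun i => ev_pairing (X i)) p.1 p.2.

End Constructions.
Arguments qev {C} X.
Arguments quote_rel C {A B} r.
Arguments quote_fun C {A B} f.

(* An exponential object of [qSet], with its universal property. *)
Record exponential C (Y Z : qset C) := Exponential {
  exp_ob : qset C;
  exp_eval : qfun (qprod exp_ob Y) Z;
  exp_univ : forall (X : qset C) (F : qfun (qprod X Y) Z),
    exists! G : qfun X exp_ob, F = bcomp exp_eval (bprod G (bid Y)) :> brel _ _
}.

Definition closed_structure C := forall Y Z : qset C, exponential Y Z.

Record category := Category {
  ob :> Type;
  mor : ob -> ob -> Type;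
  idm : forall a, mor a a;
  compm : forall a b c, mor b c -> mor a b -> mor a c;
  compmA : forall a b c d (h : mor c d) (g : mor b c) (f : mor a b),
    compm h (compm g f) = compm (compm h g) f;
  comp1m : forall a b (f : mor a b), compm (idm b) f = f;
  compm1 : forall a b (f : mor a b), compm f (idm a) = f
}.
Arguments mor {A} a b : rename.
Arguments idm {A} a : rename.
Arguments compm {A a b c} g f : rename.

(* The morphism part of a functor whose object part is [F]. *)
Record functor_map (A B : category) (F : A -> B) := FunctorMap {
  fmap : forall a b : A, mor a b -> mor (F a) (F b);
  fmap1 : forall a, fmap (idm a) = idm (F a);
  fmap_comp : forall a b c (g : mor b c) (f : mor a b),
    fmap (compm g f) = compm (fmap g) (fmap f)
}.

Record functor (A B : category) := Functor {
  fob :> A -> B;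
  fmor : functor_map fob
}.
Arguments Functor {A B} fob fmor.

(* An adjunction [F -| G], presented by its unit and counit. *)
Record adjunction (A B : category) (F : functor A B) (G : functor B A) :=
  Adjunction {
  unit_adj : forall a : A, mor a (G (F a));
  counit_adj : forall b : B, mor (F (G b)) b;
  unit_natural : forall (a a' : A) (f : mor a a'),
    compm (unit_adj a') f = compm (fmap (fmor G) (fmap (fmor F) f)) (unit_adj a);
  counit_natural : forall (b b' : B) (g : mor b b'),
    compm (counit_adj b') (fmap (fmor F) (fmap (fmor G) g)) =
    compm g (counit_adj b);
  triangle_l : forall a : A,
    compm (counit_adj (F a)) (fmap (fmor F) (unit_adj a)) = idm (F a);
  triangle_r : forall b : B,
    compm (fmap (fmor G) (counit_adj b)) (unit_adj (G b)) = idm (G b)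
}.

Section Categories.
Variable C : numClosedFieldType.

Definition qRel : category :=
  @Category (qset C) (@brel C) (@bid C) (@bcomp C)
    (@bcompA C) (@bcomp1l C) (@bcomp1r C).

Lemma qfun_compA (W X Y Z : qset C)
    (H : qfun Y Z) (G : qfun X Y) (F : qfun W X) :
  qfun_comp H (qfun_comp G F) = qfun_comp (qfun_comp H G) F.
Proof. by apply: qfun_inj; apply: bcompA. Qed.

Lemma qfun_comp1l (X Y : qset C) (F : qfun X Y) : qfun_comp (qfun_id Y) F = F.
Proof. by apply: qfun_inj; apply: bcomp1l. Qed.

Lemma qfun_comp1r (X Y : qset C) (F : qfun X Y) : qfun_comp F (qfun_id X) = F.
Proof. by apply: qfun_inj; apply: bcomp1r. Qed.

Definition qSet : category :=
  @Category (qset C) (@qfun C) (@qfun_id C) (@qfun_comp C)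
    qfun_compA qfun_comp1l qfun_comp1r.

Definition Inc_map : @functor_map qSet qRel (fun X => X) :=
  @FunctorMap qSet qRel (fun X => X) (fun _ _ F => qfun_rel F)
    (fun _ => erefl) (fun _ _ _ _ _ => erefl).

Definition Inc : functor qSet qRel := Functor _ Inc_map.

Variable expo : closed_structure C.

Definition qPow (X : qRel) : qSet := exp_ob (expo (qdual X) (quote C bool)).

Definition qPow_eval (X : qset C) :
    qfun (qprod (qPow X) (qdual X)) (quote C bool) :=
  exp_eval (expo (qdual X) (quote C bool)).

Definition qtrue : brel (qone C) (quote C bool) :=
  quote_fun C (fun _ : unit => true).

(* The equation that characterizes the relation [\ni] from [qPow X] to [X]. *)
Definition is_membership (X : qset C) (ni : brel (qPow X) X) : Prop :=
  bcomp (qev X) (bprod ni (bid (qdual X))) = bcomp (badj qtrue) (qPow_eval X).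

End Categories.
Arguments qRel C.
Arguments qSet C.
Arguments Inc C.

Definition complexC (R : realType) : numClosedFieldType := R[i].

(* Main.v *)
Require Import Defs.
From mathcomp Require Import all_boot all_order all_algebra reals complex.
From mathcomp Require Import boolp.

(** Functions into a power object and relations into its base correspond, in
    three steps, for quantum sets X and Y:

    - by the universal property of the exponential, functions G from X to
      qPow Y are the functions F = Eval o (G x I) from X x Y^* to `B;
    - functions F from a quantum set W to `B are the relations from W to 1,
      through F |-> `1^dagger o F [truth_inj, truth_classifier];
    - relations from X x Y^* to 1 are the relations R from X to Y, through
      R |-> E_Y o (R x I) [mate_inj, mate_surj].

    The second step is where functions are compared with relations. On an atom
    W_i, a relation F from W to `B is a pair (V_0, V_1) of spaces of functionals
    on W_i. The condition F o F^dagger <= I says that V_0 and V_1 are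
    orthogonal, and F^dagger o F >= I says that the identity of W_i is a sum of
    operators psi^dagger phi with phi and psi in the same V_b, which forces V_0
    to be the whole orthogonal complement of V_1 [qfun_falseE]. Conversely every
    V_1 occurs, since the operators phi^dagger phi, for phi in orthonormal bases
    of V_1 and of its complement, add up to the identity
    [resolution_of_identity]. So F carries the same information as V_1, which is
    `1^dagger o F.

    The third step holds because, on atoms, r |-> epsilon o (r (x) 1) is a
    linear isomorphism from L(X_i, Y_j) to L(X_i (x) Y_j^*, C): evaluated at
    x (x) phi, the image of r is phi(r x).

    By the third step there is exactly one relation [member] with
    E_Y o (member x I) = `1^dagger o Eval. As the product of relations is
    functorial, E_Y o ((member o G) x I) = `1^dagger o Eval o (G x I). Hence
    the composite of the three bijections is G |-> member o G, that is, [member]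
    is a universal arrow from Inc to Y [member_univ]. A choice of universal
    arrows is the counit of an adjunction [universal_adjunction]. *)

Set Implicit Arguments.
Unset Strict Implicit.
Unset Printing Implicit Defensive.

Import GRing.Theory.
Local Open Scope ring_scope.

(** * Adjunctions from universal arrows *)

Section UniversalArrows.
Variables (A B : category) (F : functor A B) (G : B -> A).
Variable eps : forall b : B, mor (F (G b)) b.
Hypothesis eps_univ : forall (a : A) (b : B) (f : mor (F a) b),
  exists! g : mor a (G b), f = compm (eps b) (fmap (fmor F) g).

Definition transpose (a : A) (b : B) (f : mor (F a) b) : mor a (G b) :=
  projT1 (cid (eps_univ f)).

Lemma transposeK (a : A) (b : B) (f : mor (F a) b) :
  compm (eps b) (fmap (fmor F) (transpose f)) = f.
Proof. by rewrite /transpose; case: cid => g []. Qed.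

Lemma eps_inj (a : A) (b : B) (g h : mor a (G b)) :
  compm (eps b) (fmap (fmor F) g) = compm (eps b) (fmap (fmor F) h) -> g = h.
Proof.
move=> gh; have [k [_ ku]] := eps_univ (compm (eps b) (fmap (fmor F) g)).
by rewrite -(ku g erefl) -(ku h gh).
Qed.

(** The right adjoint sends h : b -> b' to the transpose of h o eps_b, and the
    unit is the transpose of the identity; each law of functors and adjunctions
    then follows by [eps_inj] from the defining equation of the transposes. *)
Lemma universal_adjunction :
  exists (P : functor_map G) (adj : adjunction F (Functor G P)),
    forall b, counit_adj adj b = eps b.
Proof.
pose Gm b b' (h : mor b b') := transpose (compm h (eps b)).
have Gm_eps b b' (h : mor b b') :
    compm (eps b') (fmap (fmor F) (Gm b b' h)) = compm h (eps b).
  exact: transposeK.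
have Gm1 b : Gm b b (idm b) = idm (G b).
  by apply: eps_inj; rewrite Gm_eps fmap1 compm1 comp1m.
have GmM b b' b'' (h : mor b' b'') (k : mor b b') :
    Gm b b'' (compm h k) = compm (Gm b' b'' h) (Gm b b' k).
  by apply: eps_inj; rewrite fmap_comp compmA !Gm_eps -!compmA Gm_eps.
pose P := FunctorMap Gm1 GmM; exists P.
pose eta a := transpose (idm (F a)).
have etaK a : compm (eps (F a)) (fmap (fmor F) (eta a)) = idm (F a).
  exact: transposeK.
unshelve eexists; first apply: (@Adjunction _ _ F (Functor G P) eta eps).
- move=> a a' f; apply: eps_inj => /=.
  rewrite !fmap_comp !compmA etaK Gm_eps comp1m.
  by rewrite -compmA etaK compm1.
- exact: Gm_eps.
- exact: etaK.
- move=> b; apply: eps_inj => /=.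
  by rewrite fmap_comp compmA Gm_eps -compmA etaK fmap1.
by [].
Qed.

End UniversalArrows.

(** * Tensor products of operators and of spaces of operators *)

Section LinearAlgebra.
Variable C : numClosedFieldType.
Implicit Types X Y Z W : hilbert C.

Lemma memv_lpre (U V : vectType C) (f : U -> V) (B : {vspace V}) u :
  linear f -> (u \in linfun f @^-1: B)%VS = (f u \in B).
Proof. by move=> lf; rewrite -memv_preim linfunE. Qed.

Lemma lfun_tens_ext X Y Z (f g : 'Hom(tens_hilb X Y, Z)) :
  (forall x y, f (tens x y) = g (tens x y)) -> f = g.
Proof.
move=> fg; apply/lfunP => t; rewrite (tens_hilbE t) !linear_sum.
by apply: eq_bigr => e _; apply: fg.
Qed.

Lemma tens_map_comp X1 X2 Y1 Y2 Z1 Z2 (f1 : 'Hom(X1, Y1)) (f2 : 'Hom(X2, Y2))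
    (g1 : 'Hom(Y1, Z1)) (g2 : 'Hom(Y2, Z2)) :
  (tens_map g1 g2 \o tens_map f1 f2)%VF =
  tens_map (g1 \o f1)%VF (g2 \o f2)%VF.
Proof.
by apply: lfun_tens_ext => x y; rewrite comp_lfunE !tens_mapE !comp_lfunE.
Qed.

Lemma tens_map1 X Y :
  tens_map (\1%VF : 'Hom(X, X)) (\1%VF : 'Hom(Y, Y)) = \1%VF.
Proof. by apply: lfun_tens_ext => x y; rewrite tens_mapE !id_lfunE. Qed.

Lemma adj_tens_map X1 X2 Y1 Y2 (f : 'Hom(X1, Y1)) (g : 'Hom(X2, Y2)) :
  adj (tens_map f g) = tens_map (adj f) (adj g).
Proof.
apply: adj_uniq => s t.
rewrite (tens_hilbE s) linear_sum !linear_sumlz; apply: eq_bigr => e _.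
rewrite (tens_hilbE t) [in RHS]linear_sum !linear_sumr; apply: eq_bigr => e' _.
by rewrite /= !tens_mapE !dot_tens !adjP.
Qed.

Lemma tens_map_linl X1 X2 Y1 Y2 (g : 'Hom(X2, Y2)) :
  linear (fun f : 'Hom(X1, Y1) => tens_map f g).
Proof.
move=> a f f'; apply: lfun_tens_ext => x y.
rewrite add_lfunE scale_lfunE !tens_mapE add_lfunE scale_lfunE.
by have [tl _] := tens_bilinear Y1 Y2; rewrite tl.
Qed.

Lemma tens_map_linr X1 X2 Y1 Y2 (f : 'Hom(X1, Y1)) :
  linear (fun g : 'Hom(X2, Y2) => tens_map f g).
Proof.
move=> a g g'; apply: lfun_tens_ext => x y.
rewrite add_lfunE scale_lfunE !tens_mapE add_lfunE scale_lfunE.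
by have [_ tr] := tens_bilinear Y1 Y2; rewrite tr.
Qed.

Lemma tens_map0l X1 X2 Y1 Y2 (g : 'Hom(X2, Y2)) :
  tens_map (0 : 'Hom(X1, Y1)) g = 0.
Proof. by rewrite -(scale0r 0) (lin_scale _ _ (tens_map_linl g)) !scale0r. Qed.

Lemma tens_map0r X1 X2 Y1 Y2 (f : 'Hom(X1, Y1)) :
  tens_map f (0 : 'Hom(X2, Y2)) = 0.
Proof. by rewrite -(scale0r 0) (lin_scale _ _ (tens_map_linr f)) !scale0r. Qed.

Lemma tensv_sub X1 X2 Y1 Y2 (V : {vspace 'Hom(X1, Y1)})
    (W : {vspace 'Hom(X2, Y2)})
    (U : {vspace 'Hom(tens_hilb X1 X2, tens_hilb Y1 Y2)}) :
  (forall f g, f \in V -> g \in W -> tens_map f g \in U) -> (tensv V W <= U)%VS.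
Proof.
move=> VWU; apply/span_subvP => _ /allpairsP[[f g] /= [fV gW ->]].
by apply: VWU; apply: vbasis_mem.
Qed.

Lemma memv_tensv X1 X2 Y1 Y2 (V : {vspace 'Hom(X1, Y1)})
    (W : {vspace 'Hom(X2, Y2)}) f g :
  f \in V -> g \in W -> tens_map f g \in tensv V W.
Proof.
move=> fV gW.
have pre : (W <= linfun (tens_map f) @^-1: tensv V W)%VS.
  rewrite -{1}(span_basis (vbasisP W)); apply/span_subvP => w wW.
  rewrite memv_lpre; last exact: tens_map_linr.
  have pre : (V <= linfun (fun f => tens_map f w) @^-1: tensv V W)%VS.
    rewrite -{1}(span_basis (vbasisP V)); apply/span_subvP => v vV.
    rewrite memv_lpre; last exact: tens_map_linl.
    by apply: memv_span; apply: allpairs_f.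
  by have := subvP pre _ fV; rewrite memv_lpre //; apply: tens_map_linl.
by have := subvP pre _ gW; rewrite memv_lpre //; apply: tens_map_linr.
Qed.

Lemma comp_linl (U V W : vectType C) (r : 'Hom(U, V)) :
  linear (fun s : 'Hom(V, W) => (s \o r)%VF).
Proof. by move=> a u v; rewrite comp_lfunDl -comp_lfunZl. Qed.

Lemma comp_linr (U V W : vectType C) (s : 'Hom(V, W)) :
  linear (fun r : 'Hom(U, V) => (s \o r)%VF).
Proof. by move=> a u v; rewrite comp_lfunDr -comp_lfunZr. Qed.

(** A linear image of a product of spaces of operators lies in U as soon as the
    images of the elementary products do, as the preimage of U is a subspace.
    [tensv_ind] and [vsum_ind] hold for the same reason. *)
Lemma mulv_ind (X Y Z D : vectType C) (V : {vspace 'Hom(Y, Z)})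
    (W : {vspace 'Hom(X, Y)}) (U : {vspace D}) (f : 'Hom(X, Z) -> D) :
  linear f -> (forall s r, s \in V -> r \in W -> f (s \o r)%VF \in U) ->
  forall p, p \in mulv V W -> f p \in U.
Proof.
move=> lf fU p pVW; rewrite -memv_lpre //; apply: subvP p pVW.
by apply: mulv_sub => s r sV rW; rewrite memv_lpre // fU.
Qed.

Lemma tensv_ind X1 X2 Y1 Y2 (D : vectType C) (V : {vspace 'Hom(X1, Y1)})
    (W : {vspace 'Hom(X2, Y2)}) (U : {vspace D})
    (h : 'Hom(tens_hilb X1 X2, tens_hilb Y1 Y2) -> D) :
  linear h -> (forall f g, f \in V -> g \in W -> h (tens_map f g) \in U) ->
  forall t, t \in tensv V W -> h t \in U.
Proof.
move=> lh hU t tVW; rewrite -memv_lpre //; apply: subvP t tVW.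
by apply: tensv_sub => f g fV gW; rewrite memv_lpre // hU.
Qed.

Lemma vsum_ind (V D : vectType C) I (F : I -> {vspace V}) (U : {vspace D})
    (f : V -> D) :
  linear f -> (forall i v, v \in F i -> f v \in U) ->
  forall v, v \in vsum F -> f v \in U.
Proof.
move=> lf fU v vF; rewrite -memv_lpre //; apply: subvP v vF.
apply: vsum_sub => i; apply/subvP => v vF; rewrite memv_lpre //; exact: fU vF.
Qed.

Lemma mulv_tensv X1 X2 Y1 Y2 Z1 Z2 (V : {vspace 'Hom(X1, Y1)})
    (W : {vspace 'Hom(X2, Y2)}) (V' : {vspace 'Hom(Y1, Z1)})
    (W' : {vspace 'Hom(Y2, Z2)}) :
  mulv (tensv V' W') (tensv V W) = tensv (mulv V' V) (mulv W' W).
Proof.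
apply: subv_anti; apply/andP; split.
  apply: mulv_sub => s r sV rV.
  apply: (tensv_ind (comp_linr s)) rV => f g fV gW.
  apply: (tensv_ind (comp_linl (tens_map f g))) sV => f' g' fV' gW'.
  by rewrite tens_map_comp memv_tensv // memv_mulv.
apply: tensv_sub => p q pV qW.
apply: (mulv_ind (tens_map_linl q)) pV => f' f fV' fV.
apply: (mulv_ind (tens_map_linr (f' \o f)%VF)) qW => g' g gW' gW.
by rewrite -tens_map_comp memv_mulv // memv_tensv.
Qed.

Lemma tensvS X1 X2 Y1 Y2 (V V' : {vspace 'Hom(X1, Y1)})
    (W W' : {vspace 'Hom(X2, Y2)}) :
  (V <= V')%VS -> (W <= W')%VS -> (tensv V W <= tensv V' W')%VS.
Proof.
move=> /subvP VV /subvP WW; apply: tensv_sub => f g fV gW.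
by apply: memv_tensv; [apply: VV | apply: WW].
Qed.

Lemma adjv_tensv X1 X2 Y1 Y2 (V : {vspace 'Hom(X1, Y1)})
    (W : {vspace 'Hom(X2, Y2)}) :
  adjv (tensv V W) = tensv (adjv V) (adjv W).
Proof.
have adjvK (X Y : hilbert C) (U : {vspace 'Hom(X, Y)}) : adjv (adjv U) = U.
  by apply/vspaceP => t; rewrite !memv_adjv adjK.
have adjvS (X Y : hilbert C) (U U' : {vspace 'Hom(X, Y)}) :
    (U <= U')%VS -> (adjv U <= adjv U')%VS.
  by move=> /subvP UU; apply/subvP => t; rewrite !memv_adjv; apply: UU.
have sup (A1 A2 B1 B2 : hilbert C) (U : {vspace 'Hom(A1, B1)})
    (U' : {vspace 'Hom(A2, B2)}) :
    (tensv (adjv U) (adjv U') <= adjv (tensv U U'))%VS.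
  apply: tensv_sub => f g; rewrite !memv_adjv adj_tens_map; exact: memv_tensv.
apply: subv_anti; rewrite sup andbT.
by have := adjvS _ _ _ _ (sup _ _ _ _ (adjv V) (adjv W)); rewrite !adjvK.
Qed.

End LinearAlgebra.

(** * Functoriality of the product of relations *)

Section Products.
Variable C : numClosedFieldType.
Implicit Types X Y Z : qset C.

Lemma bprod_comp X1 X2 Y1 Y2 Z1 Z2 (S1 : brel Y1 Z1) (S2 : brel Y2 Z2)
    (R1 : brel X1 Y1) (R2 : brel X2 Y2) :
  bprod (bcomp S1 R1) (bcomp S2 R2) = bcomp (bprod S1 S2) (bprod R1 R2).
Proof.
apply: ble_anti => -[i1 i2] [k1 k2]; last first.
  apply: vsum_sub => -[j1 j2] /=; rewrite mulv_tensv /bprod /=.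
  apply: tensvS; first exact: vsum_sup (fun j => mulv (S1 j k1) (R1 i1 j)) j1.
  exact: vsum_sup (fun j => mulv (S2 j k2) (R2 i2 j)) j2.
apply: tensv_sub => p q /= p1 q2.
apply: (vsum_ind (tens_map_linl q)) p1 => j1 f fj.
apply: (vsum_ind (tens_map_linr f)) q2 => j2 g gj.
apply: (@memv_vsum _ _ _ _ (j1, j2)); rewrite mulv_tensv; exact: memv_tensv.
Qed.

Lemma bprodS X1 X2 Y1 Y2 (R R' : brel X1 Y1) (S S' : brel X2 Y2) :
  ble R R' -> ble S S' -> ble (bprod R S) (bprod R' S').
Proof. by move=> RR SS p q; apply: tensvS. Qed.

Lemma badj_bprod X1 X2 Y1 Y2 (R : brel X1 Y1) (S : brel X2 Y2) :
  badj (bprod R S) = bprod (badj R) (badj S).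
Proof. by apply: brelP => q p; apply: adjv_tensv. Qed.

Lemma bprod1 X Y : bprod (bid X) (bid Y) = bid (qprod X Y).
Proof.
apply: ble_anti => -[i j] [i' j'].
  have [ii|ii] := pselect (i = i'); last first.
    apply: tensv_sub => f g /=; rewrite {1}/bid diagv_neq // memv0 => /eqP-> _.
    by rewrite tens_map0l mem0v.
  have [jj|jj] := pselect (j = j'); last first.
    apply: tensv_sub => f g /= _; rewrite {1}/bid diagv_neq // memv0 => /eqP->.
    by rewrite tens_map0r mem0v.
  case: _ / ii; case: _ / jj; apply: tensv_sub => f g /=.
  rewrite /bid !diagv_eq => /vlineP[a ->] /vlineP[b ->].
  rewrite (lin_scale _ _ (tens_map_linl _)) (lin_scale _ _ (tens_map_linr _)).
  by rewrite tens_map1 !memvZ // memv_line.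
have [e|ne] := pselect ((i, j) = (i', j')); last first.
  by rewrite /bid diagv_neq ?sub0v.
case: e => <- <-; rewrite /bid /bprod /= !diagv_eq -memvE -tens_map1.
by apply: memv_tensv; apply: memv_line.
Qed.

Lemma is_qfun_bprod X1 X2 Y1 Y2 (F : qfun X1 Y1) (G : qfun X2 Y2) :
  is_qfun (bprod F G).
Proof.
have [[F1 F2] [G1 G2]] := (qfunP F, qfunP G).
by rewrite /is_qfun badj_bprod -!bprod_comp -!bprod1; split; apply: bprodS.
Qed.

Definition qfun_prod X1 X2 Y1 Y2 (F : qfun X1 Y1) (G : qfun X2 Y2) :
    qfun (qprod X1 X2) (qprod Y1 Y2) := QFun (is_qfun_bprod F G).

End Products.

(** * Spaces of functionals on a Hilbert space *)

Section Functionals.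
Variables (C : numClosedFieldType) (W : hilbert C).
Implicit Types (phi psi : dual_hilb W) (U : {vspace dual_hilb W}).

Notation adjd := (@adj C W scal_hilb).

(** The vector psi^dagger(1) is the Riesz representative of psi. *)
Lemma adj_dual1 phi psi : phi (adjd psi 1) = '[phi, psi].
Proof.
rewrite /adj linfunE => [|a u v]; last first.
  rewrite scaler_sumr -big_split; apply: eq_bigr => e _ /=.
  by rewrite linearDl linearZl_LR scalerDl scalerA.
rewrite linear_sum; apply: eq_bigr => e _.
rewrite linearZ [LHS]mulrC; congr (_ * _); exact: mul1r.
Qed.

Lemma scal_lfunE (V : vectType C) (f : 'Hom(@scal_hilb C, V)) (c : C) :
  f c = c *: f 1.
Proof. by rewrite -linearZ; congr (f _); rewrite /= [RHS]mulr1. Qed.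

Lemma comp_adj_dual phi psi : (phi \o adjd psi)%VF = '[phi, psi] *: \1%VF.
Proof.
apply/lfunP => c; rewrite scale_lfunE comp_lfunE id_lfunE.
rewrite (scal_lfunE (adjd psi)) linearZ /= adj_dual1.
exact: mulrC.
Qed.

(** The conditions that define functions speak of composites; this is how they
    come to express orthogonality. *)
Lemma comp_adj_dual0 phi psi :
  '[phi, psi] = 0 <-> (phi \o adjd psi)%VF = 0.
Proof.
rewrite comp_adj_dual; split=> [->|/lfunP/(_ 1)]; first by rewrite scale0r.
by rewrite scale_lfunE id_lfunE zero_lfunE => <-; rewrite [RHS]mulr1.
Qed.

Definition dual_ortho U : {vspace dual_hilb W} :=
  orthov (@hdot C (dual_hilb W)) U.

(** The witness p is the sum of the psi^dagger psi over an orthonormal basis of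
    U, that is, the projection of W onto the orthogonal complement of the common
    kernel of U. *)
Lemma ex_support U : exists p : 'Hom(W, W),
  [/\ p \in mulv (adjv U) U,
      forall phi, phi \in U -> (phi \o p)%VF = phi
    & forall phi, phi \in dual_ortho U -> (phi \o p)%VF = 0].
Proof.
have [t [ot st]] := gram_schmidt (vbasis U).
have tU (psi : dual_hilb W) : psi \in t -> psi \in U.
  by move=> psit; rewrite -(span_basis (vbasisP U)) -st memv_span.
pose p : 'Hom(W, W) := (\sum_(psi <- t) (adjd psi \o psi))%VF.
have pE phi : (phi \o p)%VF = \sum_(psi <- t) '[phi, psi] *: psi.
  apply/lfunP => x; rewrite comp_lfunE !sum_lfunE linear_sum.
  apply: eq_bigr => psi _.
  have /lfunP/(_ x) : (phi \o adjd psi \o psi)%VF = '[phi, psi] *: psi.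
    by rewrite comp_adj_dual -comp_lfunZl comp_lfun1l.
  by rewrite !comp_lfunE.
exists p; split=> [|phi|phi /mem_orthovP phiU].
- rewrite /p big_seq; apply: memv_suml => psi psit.
  by apply: memv_mulv; rewrite ?memv_adjv ?adjK tU.
- rewrite -(span_basis (vbasisP U)) -st => phit.
  have pB (psi : 'Hom(W, scal_hilb)) :
      (psi \o (p - \1))%VF = (psi \o p)%VF - psi.
    by rewrite comp_lfunDr comp_lfunNr comp_lfun1r.
  (* Both sides are linear in phi, so the basis t suffices. *)
  apply/eqP; rewrite -subr_eq0 -pB -memv0.
  rewrite -(memv_lpre _ _ (comp_linl (W := scal_hilb) (p - \1%VF))).
  apply: subvP phit; apply/span_subvP => psi psit.
  rewrite memv_lpre; last exact: comp_linl.
  have /orthonormalP[ut dt] := ot.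
  rewrite pB memv0 subr_eq0 pE (bigD1_seq psi) //= dt // eqxx scale1r.
  rewrite big1_seq ?addr0 // => psi' /andP[ne psi't].
  by rewrite dt // eq_sym (negPf ne) scale0r.
by rewrite pE big1_seq // => psi /andP[_ psit]; rewrite phiU ?scale0r ?tU.
Qed.

Lemma dual_orthoP U phi :
  (forall psi, psi \in U -> (phi \o adjd psi)%VF = 0) <-> phi \in dual_ortho U.
Proof.
split=> [h|/mem_orthovP h psi psiU]; last by apply/comp_adj_dual0/h.
by apply/mem_orthovP => psi psiU; apply/comp_adj_dual0/h.
Qed.

Lemma dual_ortho_split U phi :
  exists x y, [/\ phi = x + y, x \in U & y \in dual_ortho U].
Proof.
have [x xU [y [-> _ /orthoPl yU]]] :=
  orthogonal_split (@hdot C (dual_hilb W)) (vbasis U) phi.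
exists x, y; split=> //; first by rewrite -(span_basis (vbasisP U)).
rewrite /dual_ortho mem_orthov_sym -{1}(span_basis (vbasisP U)).
apply/span_subvP => z zU; rewrite mem_orthov1.
by rewrite herm_eq0C; apply/eqP/yU.
Qed.

Lemma dual_orthoK U phi : phi \in U -> phi \in dual_ortho (dual_ortho U).
Proof.
move=> phiU; apply/mem_orthovP => z /mem_orthovP zU.
by apply/eqP; rewrite herm_eq0C; apply/eqP/zU.
Qed.

(** The sum of the projections attached by [ex_support] to U and to its
    complement is absorbed on the right by every functional, and functionals
    separate the points of W. *)
Lemma resolution_of_identity U :
  (\1%VF : 'Hom(W, W)) \in
    (mulv (adjv U) U + mulv (adjv (dual_ortho U)) (dual_ortho U))%VS.
Proof.
have [p [pU p1 p0]] := ex_support U.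
have [q [qU q1 q0]] := ex_support (dual_ortho U).
suff -> : (\1%VF : 'Hom(W, W)) = p + q by apply: memv_add.
have pq phi : (phi \o (p + q))%VF = phi.
  have [x [y [-> xU yU]]] := dual_ortho_split U phi.
  rewrite comp_lfunDl !comp_lfunDr (p1 x) // (p0 y) // (q1 y) //.
  by rewrite (q0 x) ?dual_orthoK // addr0 add0r.
apply/lfunP => x; apply/hdot_inj => z; rewrite id_lfunE.
rewrite hdotC [RHS]hdotC; congr (_^*).
by rewrite -!braE -[in LHS](pq (bra z)) comp_lfunE.
Qed.

End Functionals.

(** * Functions to the quantum set of truth values *)

Section Classifier.
Variable C : numClosedFieldType.
Implicit Types W X Y Z : qset C.

Lemma scal_endo (s : 'Hom(@scal_hilb C, @scal_hilb C)) : s = (s 1 : C) *: \1%VF.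
Proof.
apply/lfunP => c; rewrite scale_lfunE id_lfunE scal_lfunE; exact: mulrC.
Qed.

Definition truth W (F : brel W (quote C bool)) : brel W (qone C) :=
  bcomp (badj (@qtrue C)) F.

(** The adjoint of `1 is zero on the atom false and consists of the scalars on
    the atom true, so composing with it selects the component at true. *)
Lemma truthE W (F : brel W (quote C bool)) i t : truth F i t = F i true.
Proof.
have qtrueE b : @qtrue C tt b = if b then fullv else 0%VS.
  rewrite /qtrue /quote_fun /quote_rel; case: asboolP => [<-//|].
  by case: b.
case: t; apply: subv_anti; apply/andP; split.
  apply: vsum_sub => -[]; apply: mulv_sub => s r; rewrite memv_adjv qtrueE.
    2: rewrite memv0 -[s in (s \o r)%VF]adjK => /eqP-> _.
    2: by rewrite adj0 comp_lfun0l mem0v.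
  move=> _ rF; by rewrite (scal_endo s) -comp_lfunZl comp_lfun1l memvZ.
apply/subvP => f fF; apply: (@memv_vsum _ _ _ _ true).
rewrite -[f]comp_lfun1l; apply: memv_mulv => //.
by rewrite memv_adjv qtrueE memvf.
Qed.

(** A functional phi orthogonal to F(i, true) is phi o 1, and 1 is a sum of
    operators s r with r and s^dagger both in F(i, true) or both in F(i, false).
    In the first case phi s r vanishes; in the second it is a multiple of r. *)
Lemma qfun_falseE W (F : qfun W (quote C bool)) i :
  qfun_rel F i false = dual_ortho (qfun_rel F i true).
Proof.
have [F1 F2] := qfunP F; apply/vspaceP => phi; apply/idP/idP => [phiF|].
  apply/dual_orthoP => psi psiF; apply/eqP; rewrite -memv0.
  rewrite -(diagv_neq (V := fun i j => 'Hom(quote C bool i, quote C bool j))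
    (fun i => \1%VF) (i := true) (j := false)) //.
  apply: subvP (F2 true false) _ _; apply: (@memv_vsum _ _ _ _ i).
  by apply: memv_mulv; rewrite ?memv_adjv ?adjK.
move=> /dual_orthoP phiF; rewrite -[phi]comp_lfun1r.
have id1 : (\1%VF : 'Hom(W i, W i)) \in bcomp (badj F) F i i.
  by apply: subvP (F1 i i) _ _; rewrite /bid diagv_eq memv_line.
apply: (vsum_ind (comp_linr phi)) id1 => -[] f;
  apply: (mulv_ind (comp_linr phi)) => s r;
  rewrite memv_adjv comp_lfunA => sF rF.
  by rewrite -[s]adjK phiF // comp_lfun0l mem0v.
by rewrite -[s]adjK comp_adj_dual -comp_lfunZl comp_lfun1l memvZ.
Qed.

Lemma truth_inj W (F G : qfun W (quote C bool)) : truth F = truth G -> F = G.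
Proof.
move=> FG; have FGt i : qfun_rel F i true = qfun_rel G i true.
  by rewrite -!(truthE _ i tt) FG.
by apply: qfun_inj; apply: brelP => i [] //; rewrite !qfun_falseE FGt.
Qed.

Definition classify W (S : brel W (qone C)) : brel W (quote C bool) :=
  fun i b => if b then S i tt else dual_ortho (S i tt).

(** The two conditions are the resolution of the identity of each atom and the
    orthogonality of a space of functionals to its complement. *)
Lemma is_qfun_classify W (S : brel W (qone C)) : is_qfun (classify S).
Proof.
split=> [i j|b b'].
  have [ij|ij] := pselect (i = j); last by rewrite /bid diagv_neq ?sub0v.
  case: _ / ij; rewrite /bid diagv_eq -memvE.
  apply: subvP (resolution_of_identity (S i tt)); rewrite subv_add.
  pose V b := mulv (badj (classify S) b i) (classify S i b).
  by apply/andP; split; [exact: vsum_sup V true | exact: vsum_sup V false].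
apply: vsum_sub => i; apply: mulv_sub => s r; rewrite memv_adjv.
have [bb|bb] := pselect (b = b').
  case: _ / bb s => s _ _; rewrite /bid diagv_eq.
  by rewrite (scal_endo (s \o r)%VF) memvZ // memv_line.
rewrite /bid diagv_neq // memv0 -{2}[r]adjK => sS rS; apply/eqP.
suff /dual_orthoP : s \in dual_ortho (classify S i b) by apply.
case: b b' bb s r sS rS => -[] // _ s r sS _.
exact: dual_orthoK sS.
Qed.

Definition classifier W (S : brel W (qone C)) : qfun W (quote C bool) :=
  QFun (is_qfun_classify S).

Lemma truth_classifier W (S : brel W (qone C)) : truth (classifier S) = S.
Proof. by apply: brelP => i []; rewrite truthE. Qed.

End Classifier.

(** * Relations from X to Y as relations from X x Y^* to 1 *)

Section Transposition.
Variable C : numClosedFieldType.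

Definition pairing_with (X Y : hilbert C) (r : 'Hom(X, Y)) :
    'Hom(tens_hilb X (dual_hilb Y), @scal_hilb C) :=
  (ev_pairing Y \o tens_map r \1)%VF.

Lemma pairing_withE (X Y : hilbert C) (r : 'Hom(X, Y)) x (phi : dual_hilb Y) :
  pairing_with r (tens x phi) = phi (r x).
Proof. by rewrite comp_lfunE tens_mapE ev_pairingE id_lfunE. Qed.

Lemma pairing_with_linear (X Y : hilbert C) : linear (@pairing_with X Y).
Proof.
move=> a r s; rewrite /pairing_with tens_map_linl.
exact: comp_linr.
Qed.

Lemma pairing_with_inj (X Y : hilbert C) : injective (@pairing_with X Y).
Proof.
move=> r s rs; apply/lfunP => x; apply: hdot_inj => z.
by rewrite hdotC [RHS]hdotC -!braE -!pairing_withE rs.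
Qed.

Lemma dual_dec (Y : hilbert C) (phi : dual_hilb Y) :
  phi = \sum_(e <- onb Y) phi e *: bra e.
Proof.
apply/lfunP => y; rewrite sum_lfunE {1}(onb_dec y) linear_sum.
by apply: eq_bigr => e _; rewrite linearZ scale_lfunE braE [LHS]mulrC.
Qed.

(** The preimage of f sends x to the vector on which each functional phi takes
    the value f(x (x) phi); its coordinates in an orthonormal basis are the
    values of f at the dual basis. *)
Lemma pairing_with_surj (X Y : hilbert C)
    (f : 'Hom(tens_hilb X (dual_hilb Y), @scal_hilb C)) :
  exists r : 'Hom(X, Y), pairing_with r = f.
Proof.
have [tl tr] := tens_bilinear X (dual_hilb Y).
pose g x : Y := \sum_(e <- onb Y) (f (tens x (bra e)) : C) *: e.
have lg : linear g.
  move=> a x y; rewrite /g scaler_sumr -big_split; apply: eq_bigr => e _ /=.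
  by rewrite tl linearP scalerDl scalerA.
exists (linfun g); apply: lfun_tens_ext => x phi.
rewrite pairing_withE linfunE // [in RHS](dual_dec phi) (lin_sum _ _ _ (tr x)).
rewrite !linear_sum; apply: eq_bigr => e _; rewrite !linearZ; exact: mulrC.
Qed.

Implicit Types X Y Z : qset C.

Definition mate X Y (R : brel X Y) : brel (qprod X (qdual Y)) (qone C) :=
  bcomp (qev Y) (bprod R (bid (qdual Y))).

(** In the sum over the atoms (k, l) of Y x Y^* that defines the composite, E_Y
    kills the terms with k <> l and the identity of Y^* those with l <> j. *)
Lemma mateE X Y (R : brel X Y) i j t :
  mate R (i, j) t = (linfun (@pairing_with (X i) (Y j)) @: R i j)%VS.
Proof.
have pl := @pairing_with_linear (X i) (Y j).
apply: subv_anti; apply/andP; split; last first.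
  apply/subvP => _ /memv_imgP[r rR ->]; rewrite linfunE //.
  apply: (@memv_vsum _ _ _ _ (j, j)); apply: memv_mulv.
    by rewrite /qev diagv_eq memv_line.
  by apply: memv_tensv; rewrite // /bid diagv_eq memv_line.
apply: vsum_sub => -[k l]; have [kl|kl] := pselect (k = l); last first.
  apply: mulv_sub => s q; rewrite /qev diagv_neq // memv0 => /eqP-> _.
  by rewrite comp_lfun0l mem0v.
have [jl|jl] := pselect (j = l); last first.
  apply: mulv_sub => s q _; apply: (tensv_ind (comp_linr s)) => r g _.
  rewrite /bid diagv_neq // memv0 => /eqP->.
  by rewrite tens_map0r comp_lfun0r mem0v.
case: _ / jl in kl *; case: _ / (esym kl); apply: mulv_sub => s q.
rewrite /qev diagv_eq => /vlineP[a ->] qR; rewrite -comp_lfunZl; apply: memvZ.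
apply: (tensv_ind (comp_linr _)) qR => /= r g rR.
rewrite /bid diagv_eq => /vlineP[b ->].
rewrite (lin_scale _ _ (tens_map_linr _)) -comp_lfunZr; apply: memvZ.
by rewrite -[(_ \o _)%VF]/(pairing_with r) -(linfunE pl); apply: memv_img.
Qed.

Lemma mate_inj X Y : injective (@mate X Y).
Proof.
move=> R S RS; apply: brelP => i j.
have pl := @pairing_with_linear (X i) (Y j).
apply/eqP; rewrite -(@eq_limg_ker0 _ _ _ (linfun (@pairing_with (X i) (Y j)))).
  by rewrite -!(mateE _ i j tt) RS.
by apply/lker0P => r s; rewrite !linfunE // => /pairing_with_inj.
Qed.

Lemma mate_surj X Y (S : brel (qprod X (qdual Y)) (qone C)) :
  exists R : brel X Y, mate R = S.
Proof.
exists (fun i j => linfun (@pairing_with (X i) (Y j)) @^-1: S (i, j) tt)%VS.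
apply: brelP => -[i j] []; rewrite mateE lpreimK //.
apply/subvP => f _; have [r <-] := pairing_with_surj f.
rewrite -linfunE; last exact: pairing_with_linear.
exact: memv_img (memvf _).
Qed.

Lemma mate_comp X Y Z (R : brel Y Z) (S : brel X Y) :
  mate (bcomp R S) = bcomp (mate R) (bprod S (bid (qdual Z))).
Proof. by rewrite /mate -bcompA -bprod_comp bcomp1l. Qed.

End Transposition.

(** * The power object and its membership relation *)

Section PowerObject.
Variables (C : numClosedFieldType) (expo : closed_structure C).
Implicit Types X Y Z : qset C.

Lemma ex_membership X : exists ni : brel (qPow expo X) X, is_membership ni.
Proof. exact: mate_surj. Qed.

Definition member X : brel (qPow expo X) X := projT1 (cid (ex_membership X)).

Lemma memberP X : mate (@member X) = truth (qPow_eval expo X).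
Proof. exact: projT2 (cid (ex_membership X)). Qed.

Lemma mate_member X Y (G : qfun X (qPow expo Y)) :
  mate (bcomp (@member Y) G) =
  truth (qfun_comp (qPow_eval expo Y) (qfun_prod G (qfun_id (qdual Y)))).
Proof. by rewrite mate_comp memberP /truth -bcompA. Qed.

(** The truth of a function into `B determines it, so the universal property of
    Eval at the classifier of the mate of R becomes that of [member] at R. *)
Lemma member_univ X Y (R : brel X Y) :
  exists! G : qfun X (qPow expo Y), R = bcomp (@member Y) G.
Proof.
have [G [GE Gu]] :=
  exp_univ (expo (qdual Y) (quote C bool)) (classifier (mate R)).
exists G; split=> [|H RH].
  by apply: mate_inj; rewrite mate_member -[LHS]truth_classifier /truth GE.
apply: Gu; rewrite (_ : classifier (mate R) =
  qfun_comp (qPow_eval expo Y) (qfun_prod H (qfun_id (qdual Y)))) //.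
by apply: truth_inj; rewrite truth_classifier RH mate_member.
Qed.

End PowerObject.
Arguments member {C} expo X i j.

Theorem theorem9p2 (R : realType) (expo : closed_structure (complexC R)) :
  exists (P : functor_map (qPow expo))
         (A : adjunction (Inc (complexC R)) (Functor (qPow expo) P)),
    forall X : qset (complexC R),
      unique (@is_membership (complexC R) expo X) (counit_adj A X).
Proof.
have [P [A AE]] := @universal_adjunction (qSet _) (qRel _) (Inc (complexC R))
  (qPow expo) (member expo) (@member_univ _ expo).
exists P, A => X; rewrite AE; split=> [|ni niP]; first exact: memberP.
by apply: mate_inj; rewrite memberP.
Qed.
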